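(* Let $n\ge 1$, and let $so(2n,\mathbb{C})\subset sl(2n,\mathbb{C})$ be the subalgebra of matrices skew-adjoint relative to the quadratic form $\sum_{i=1}^{n}z_iz_{2n+1-i}$. The standard $so(2n,\mathbb{C})$-compatible parabolic subalgebras of $sl(2n,\mathbb{C})$ are exactly those $\mathfrak{p}_\Pi$, $\Pi\subseteq\Delta=\{\alpha_k-\alpha_{k+1}\mid 1\le k\le 2n-1\}$, such that for all $1\le k\le n-1$ either $\{\alpha_k-\alpha_{k+1},\ \alpha_{2n-k}-\alpha_{2n+1-k}\}\subseteq\Pi$ or $\{\alpha_k-\alpha_{k+1},\ \alpha_{2n-k}-\alpha_{2n+1-k}\}\cap\Pi=\emptyset$.
   Context: The Cartan subalgebra $\mathfrak{h}$ of $\mathfrak{g}=sl(2n,\mathbb{C})$ is the set of trace-zero diagonal matrices, $\alpha_k(\mathrm{diag}(a_1,\dots,a_{2n}))=a_k$, and $\Delta$ is the simple system $\{\alpha_k-\alpha_{k+1}\mid 1\le k\le 2n-1\}$ with positive system $\Phi^+$. The diagonal matrices in $so(2n,\mathbb{C})$, namely $\mathrm{diag}(b_1,\dots,b_n,-b_n,\dots,-b_1)$, form a Cartan subalgebra of it. For $\Pi\subseteq\Delta$, the standard parabolic subalgebra is $\mathfrak{p}_\Pi=\mathfrak{h}+\sum_{\alpha\in\Phi^+}\mathfrak{g}_\alpha+\sum_{\alpha\in\mathbb{N}\Pi\cap\Phi^+}\mathfrak{g}_{-\alpha}$, where $\mathfrak{g}_\alpha$ is the root space of $\alpha$ and $\mathbb{N}\Pi$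 denotes the non-negative integer combinations of elements of $\Pi$. A semisimple element $H\in\mathfrak{g}$ is hyperbolic if all eigenvalues of $\mathrm{ad}(H)$ on $\mathfrak{g}$ are real; for such $H$, $\mathfrak{p}(H)$ is the sum of the eigenspaces of $\mathrm{ad}(H)$ with eigenvalues $\ge 0$, a parabolic subalgebra of $\mathfrak{g}$. For a reductive subalgebra $\mathfrak{g}'$ of $\mathfrak{g}$, a parabolic subalgebra $\mathfrak{p}$ of $\mathfrak{g}$ is $\mathfrak{g}'$-compatible if there exists $H\in\mathfrak{g}'$, hyperbolic as an element of $\mathfrak{g}$, with $\mathfrak{p}=\mathfrak{p}(H)$. *)

(* Defs.v *)
From HB Require Import structures.
From mathcomp Require Import all_boot all_order all_algebra.
From mathcomp Require Import complex.
From mathcomp Require Import boolp classical_sets reals.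

Set Implicit Arguments.
Unset Strict Implicit.
Unset Printing Implicit Defensive.

Import Order.TTheory GRing.Theory Num.Theory.

Local Open Scope classical_set_scope.
Local Open Scope ring_scope.

Definition sum_set (V : zmodType) (A B : set V) : set V :=
  [set x + y | x in A & y in B].

(* The sum of a possibly infinite family of subspaces V i, for i such that
   P i: all finite sums of elements of the V i. *)
Definition sum_family (I : choiceType) (V : zmodType)
    (P : set I) (F : I -> set V) : set V :=
  [set x | exists2 s : seq (I * V),
     (forall u, u \in s -> P u.1 /\ F u.1 u.2) & x = \sum_(u <- s) u.2].

Definition nat_span (V : zmodType) (S : set V) : set V :=
  [set x | exists2 s : seq V, (forall a, a \in s -> S a) &
     exists c : V -> nat, x = \sum_(a <- s) a *+ c a].

Section SpecialLinear.
Variables (R : realType) (m : nat).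
Local Notation C := R[i].
Local Notation gl := 'M[C]_m.

Definition sl : {vspace gl} := lker (linfun (mxtrace : gl -> C^o)).

Definition cartan : {vspace gl} :=
  (limg (linfun (@diag_mx C m)) :&: sl)%VS.

Definition cartan_dual := 'Hom(subvs_of cartan, C^o).

Definition bracket (X Y : gl) : gl := X *m Y - Y *m X.

Definition ad (H : gl) : 'End(gl) := linfun (bracket H).

Definition diag_entry (k : nat) (H : subvs_of cartan) : C^o :=
  \sum_(i < m | i.+1 == k) vsval H i i.

(* The functional diag(a_1, ..., a_m) |-> a_k. Diagonal positions are counted
   from 1, whereas 'I_m counts from 0; alpha k = 0 unless 1 <= k <= m. *)
Definition alpha (k : nat) : cartan_dual := linfun (diag_entry k).

Definition simple_root (k : nat) : cartan_dual := alpha k - alpha k.+1.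

Definition Delta : set cartan_dual :=
  [set simple_root k | k in [set k | (1 <= k < m)%N]].

Definition root_space (a : cartan_dual) : set gl :=
  [set X | X \in sl /\
     forall H : subvs_of cartan, bracket (vsval H) X = a H *: X].

Definition roots : set cartan_dual :=
  [set a | a != 0 /\ exists2 X, root_space a X & X != 0].

Definition positive_roots : set cartan_dual := roots `&` nat_span Delta.

Definition std_parabolic (Pi : set cartan_dual) : set gl :=
  sum_set
    (sum_set [set` cartan] (sum_family positive_roots root_space))
    (sum_family (nat_span Pi `&` positive_roots) (fun a => root_space (- a))).

(* Eigenspaces of ad H acting on sl, not on all matrices. *)
Definition ad_eigenspace (H : gl) (c : C) : {vspace gl} :=
  (passmx.leigenspace (ad H) c :&: sl)%VS.

Definition semisimple (H : gl) : Prop :=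
  sum_family setT (fun c => [set` ad_eigenspace H c]) = [set` sl].

Definition hyperbolic (H : gl) : Prop :=
  [/\ H \in sl, semisimple H &
      forall c : C, ad_eigenspace H c != 0%VS -> c \is Num.real].

(* In R[i], 0 <= c means that c is real and nonnegative. *)
Definition parabolic_of (H : gl) : set gl :=
  sum_family [set c : C | 0 <= c] (fun c => [set` ad_eigenspace H c]).

Definition compatible (g' : set gl) (p : set gl) : Prop :=
  exists H : gl, [/\ g' H, hyperbolic H & p = parabolic_of H].

Lemma mem_sl (X : gl) : (X \in sl) = (\tr X == 0).
Proof. by rewrite memv_ker lfunE. Qed.

Lemma mem_cartan (X : gl) : (X \in cartan) = is_diag_mx X && (\tr X == 0).
Proof.
rewrite memv_cap mem_sl; congr (_ && _); apply/idP/is_diag_mxP.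
  by case/memv_imgP => d _ ->; rewrite lfunE /= => i j ij;
    rewrite mxE (introF eqP) ?mulr0n // => eij; rewrite eij eqxx in ij.
move=> dX; apply/memv_imgP; exists (\row_i X i i); rewrite ?memvf // lfunE /=.
apply/matrixP => i j; rewrite !mxE; case: eqVneq => [->|ij] //=.
exact: dX.
Qed.

Lemma adE (H X : gl) : ad H X = bracket H X.
Proof.
have lin : linear (bracket H).
  move=> c Y Z; rewrite /bracket mulmxDr mulmxDl -scalemxAr -scalemxAl.
  by rewrite opprD addrACA scalerBr.
pose isL := GRing.isLinear.Build C gl gl *:%R (bracket H) lin.
pose f : {linear gl -> gl} := HB.pack (bracket H) isL.
exact: (lfunE f X).
Qed.

Lemma alphaE (k : nat) (H : subvs_of cartan) : alpha k H = diag_entry k H.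
Proof.
have lin : linear (diag_entry k).
  move=> c Y Z; rewrite /diag_entry scaler_sumr -big_split /=.
  by apply: eq_bigr => i _; rewrite !mxE.
pose isL := GRing.isLinear.Build C (subvs_of cartan) C^o *:%R (diag_entry k) lin.
pose f : {linear subvs_of cartan -> C^o} := HB.pack (diag_entry k) isL.
exact: (lfunE f H).
Qed.

Lemma mem_ad_eigenspace (H X : gl) (c : C) :
  (X \in ad_eigenspace H c) = (X \in sl) && (bracket H X == c *: X).
Proof.
rewrite memv_cap andbC; congr (_ && _); rewrite memv_ker.
by rewrite add_lfunE opp_lfunE scale_lfunE id_lfunE adE subr_eq0.
Qed.

End SpecialLinear.

Arguments sl {R m}.
Arguments cartan {R m}.
Arguments alpha {R m}.
Arguments simple_root {R m}.
Arguments Delta {R m}.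
Arguments roots {R m}.
Arguments positive_roots {R m}.

Section SpecialOrthogonal.
Variables (R : realType) (n : nat).
Local Notation C := R[i].

(* z_1 z_{2n} + ... + z_n z_{n+1}: with indices counted from 0, z_{2n+1-i}
   is the entry at rev_ord of the position of z_i. *)
Definition quad_form (z : 'cV[C]_(2 * n)) : C :=
  \sum_(i < 2 * n | (i < n)%N) z i 0 * z (rev_ord i) 0.

Definition polar_form (z w : 'cV[C]_(2 * n)) : C :=
  quad_form (z + w) - quad_form z - quad_form w.

(* Skew-adjointness is insensitive to the usual factor 1/2 in the polar form. *)
Definition so : set 'M[C]_(2 * n) :=
  [set X | X \in sl /\
     forall z w : 'cV[C]_(2 * n),
       polar_form (X *m z) w = - polar_form z (X *m w)].

End SpecialOrthogonal.

Arguments so {R n}.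

(* Main.v *)
Require Import Defs.
From mathcomp Require Import all_boot all_order all_algebra.
From mathcomp Require Import complex.
From mathcomp Require Import boolp classical_sets reals.
From mathcomp Require Import zify ring.

Set Implicit Arguments.
Unset Strict Implicit.
Unset Printing Implicit Defensive.

Import Order.TTheory GRing.Theory Num.Theory.

Local Open Scope classical_set_scope.
Local Open Scope ring_scope.

(** Both implications rest on describing subspaces of sl(m) by the matrix
    positions at which their elements may be nonzero.

    With indices counted from 0, the root space of alpha_(i+1) - alpha_(j+1) is
    the line of the matrix unit E_ij, and this root is a positive one in the span
    of Pi exactly when i < j and Pi contains every simple root number k with
    i < k <= j: telescoping gives one direction, and evaluating at the
    fundamental coweights, on each of which all simple roots but one vanish, gives
    the other.  Hence the parabolic attached to Pi consists of the matrices X of sl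
    such that X i j != 0 with j < i forces Pi to contain the simple roots k with
    j < k <= i ([std_parabolic_support]).  In particular Pi can be read off the
    parabolic from the matrix units just below the diagonal
    ([delta_std_parabolic]).

    The algebra so(2n) is cut out of sl(2n) by flip H = - H, where flip is the
    reflection in the antidiagonal ([soE]).

    If the parabolic is p(H) with H in so(2n): flip reverses products, so it
    commutes with ad H, hence preserves every eigenspace of ad H and p(H) itself
    ([flip_parabolic_of]).  This uses nothing about the shape of H, so H need not
    be conjugated into the Cartan subalgebra.  As flip exchanges the matrix units
    below the diagonal for the simple roots k and 2n - k, membership in Pi is
    invariant under this exchange ([flip_std_parabolic]).

    Conversely, let H be 2n times the sum of the fundamental coweights of the simple
    roots outside Pi.  The entries of H decrease weakly down the diagonal, strictly at
    step k exactly when the simple root k lies outside Pi, so p(H) is the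
    parabolic of Pi ([parabolic_of_facet_elt]).  Reversing the order of the
    entries sends the k-th coweight to minus the (2n - k)-th one, so the symmetry
    of Pi puts H in so(2n) ([flip_facet_elt]).  The middle simple root n is its
    own partner, so the symmetry is a condition on the pairs with k < n only. *)

Section StandardParabolics.
Variables (R : realType) (m : nat).
Local Notation C := R[i].
Local Notation gl := 'M[C]_m.

(** * Subspaces cut out by the positions of nonzero entries *)

Definition sl_support (P : 'I_m -> 'I_m -> Prop) : set gl :=
  [set X | X \in sl /\ forall i j, X i j != 0 -> P i j].

Lemma sl_support_add P X Y :
  sl_support P X -> sl_support P Y -> sl_support P (X + Y).
Proof.
move=> [sX PX] [sY PY]; split=> [|i j]; first exact: memvD.
rewrite mxE; have [->|/PX//] := eqVneq (X i j) 0.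
by rewrite add0r; exact: PY.
Qed.

Lemma sl_support_sum P (I : eqType) (s : seq I) (F : I -> gl) :
  (forall u, u \in s -> sl_support P (F u)) -> sl_support P (\sum_(u <- s) F u).
Proof.
move=> sF; rewrite big_seq; elim/big_ind: _ => //.
- by split=> [|i j]; [exact: mem0v | rewrite mxE eqxx].
- exact: sl_support_add.
Qed.

Definition diag_part (X : gl) : gl := diag_mx (\row_i X i i).

Lemma diag_part_cartan X : X \in sl -> diag_part X \in cartan.
Proof.
rewrite mem_sl mem_cartan diag_mx_is_diag mxtrace_diag => /eqP tX /=.
by under eq_bigr do rewrite mxE; apply/eqP.
Qed.

Lemma delta_sl (i j : 'I_m) : i != j -> (delta_mx i j : gl) \in sl.
Proof.
move=> nij; rewrite mem_sl; apply/eqP/big1 => k _; rewrite mxE.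
by case: eqVneq => // ->; rewrite (negbTE nij).
Qed.

(** Zero entries are left out, as their positions need not satisfy the support
    condition at hand. *)
Definition off_diag (Q : rel 'I_m) (X : gl) : seq ('I_m * 'I_m) :=
  [seq p <- enum {: 'I_m * 'I_m} | Q p.1 p.2 && (X p.1 p.2 != 0)].

Definition off_part (Q : rel 'I_m) (X : gl) : gl :=
  \sum_(p <- off_diag Q X) X p.1 p.2 *: delta_mx p.1 p.2.

Lemma mem_off_diag Q X p : (p \in off_diag Q X) = Q p.1 p.2 && (X p.1 p.2 != 0).
Proof. by rewrite mem_filter mem_enum andbT. Qed.

Lemma off_partE Q X i j : off_part Q X i j = if Q i j then X i j else 0.
Proof.
rewrite /off_part /off_diag big_filter big_enum_cond /= summxE big_mkcond /=.
rewrite (bigD1 (i, j)) //= big1 => [|[k l] nkl].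
  rewrite !mxE !eqxx mulr1 addr0.
  by case: (Q i j) => //=; case: eqVneq => [->|].
case: ifP => // _; rewrite !mxE /=.
case: (eqVneq i k) nkl => [<-|]; last by rewrite mulr0.
case: (eqVneq j l) => [<-|]; last by rewrite mulr0.
by rewrite eqxx.
Qed.

Lemma bracket_diagE (d : 'rV[C]_m) (X : gl) i j :
  bracket (diag_mx d) X i j = (d 0 i - d 0 j) * X i j.
Proof. by rewrite mxE mul_diag_mx mxE mxE mul_mx_diag mxE; ring. Qed.

Lemma bracket_diag_delta (d : 'rV[C]_m) i j :
  bracket (diag_mx d) (delta_mx i j) = (d 0 i - d 0 j) *: delta_mx i j.
Proof.
apply/matrixP => k l; rewrite bracket_diagE !mxE.
by case: (eqVneq k i) => [->|]; case: (eqVneq l j) => [->|] //=; rewrite !mulr0.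
Qed.

(** The matrix unit E_ij is an eigenvector of ad (diag d) for d_i - d_j, so a sum
    of eigenspaces is spanned by matrix units together with the diagonal part,
    which has eigenvalue 0; hence the hypothesis [P 0].  Both semisimplicity of
    diagonal elements and the parabolics they define are instances. *)
Lemma sum_eigenspaces_diag (P : set C) (d : 'rV[C]_m) : P 0 ->
  sum_family P (fun c => [set` ad_eigenspace (diag_mx d) c])
    = sl_support (fun i j => P (d 0 i - d 0 j)).
Proof.
move=> P0; apply/seteqP; split=> X /=.
  case=> s sP ->; apply: sl_support_sum => -[c Y] /sP [/= Pc].
  rewrite mem_ad_eigenspace => /andP[sY /eqP eY]; split=> // i j nY.
  move/matrixP/(_ i j)/eqP: eY; rewrite bracket_diagE mxE.
  by rewrite (inj_eq (mulIf nY)) => /eqP ->.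
case=> sX PX.
exists ((0, diag_part X) :: [seq (d 0 p.1 - d 0 p.2,
          X p.1 p.2 *: delta_mx p.1 p.2) | p <- off_diag [rel i j | i != j] X]).
  move=> u; rewrite inE => /predU1P[-> /=|/mapP[[i j]]].
    have := diag_part_cartan sX; rewrite memv_cap => /andP[_ sD].
    rewrite mem_ad_eigenspace sD scale0r; split=> //; apply/eqP/matrixP => i j.
    rewrite bracket_diagE !mxE; case: eqVneq => [->|_].
      by rewrite subrr mul0r.
    by rewrite mulr0.
  rewrite mem_off_diag /= => /andP[nij nX] -> /=; split; first exact: PX.
  rewrite mem_ad_eigenspace memvZ ?delta_sl //=.
  rewrite {1}/bracket -scalemxAl -scalemxAr -scalerBr -/(bracket _ _).
  by rewrite bracket_diag_delta !scalerA mulrC.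
rewrite big_cons big_map /= -/(off_part _ X).
apply/matrixP => i j; rewrite !mxE off_partE /=.
by case: eqVneq => [->|_] /=; rewrite ?mulr1n ?addr0 ?mulr0n ?add0r.
Qed.

(** * Root spaces and coweights *)

(** In terms of 0-based positions i and j; for i = j this is 0, not a root. *)
Definition alpha_diff (i j : nat) : cartan_dual R m := alpha i.+1 - alpha j.+1.

Lemma cartan_diag (h : subvs_of (cartan : {vspace gl})) :
  vsval h = diag_mx (\row_i vsval h i i).
Proof.
have := subvsP h; rewrite mem_cartan => /andP[/is_diag_mxP dh _].
apply/matrixP => i j; rewrite !mxE; case: eqVneq => [->|/dh ->] //.
Qed.

Lemma alpha_ord (i : 'I_m) h : alpha i.+1 h = vsval h i i :> C^o.
Proof.
by rewrite alphaE /diag_entry (eq_bigl (pred1 i)) ?big_pred1_eq.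
Qed.

Lemma alpha_diff_ord (i j : 'I_m) h :
  alpha_diff i j h = vsval h i i - vsval h j j :> C^o.
Proof. by rewrite add_lfunE opp_lfunE !alpha_ord. Qed.

(** A nonzero entry at (i, j) pins down the functional, because ad h multiplies
    that entry by h_i - h_j. *)
Lemma root_space_support a X (i j : 'I_m) :
  root_space a X -> X i j != 0 -> a = alpha_diff i j.
Proof.
case=> _ aX nX; apply/lfunP => h; rewrite alpha_diff_ord.
move/matrixP/(_ i j): (aX h); rewrite {1}cartan_diag bracket_diagE !mxE.
by move/(mulIf nX) => ->.
Qed.

Lemma delta_root_space (i j : 'I_m) c : i != j ->
  root_space (alpha_diff i j) (c *: delta_mx i j).
Proof.
move=> nij; split=> [|h]; first by rewrite memvZ // delta_sl.
rewrite {1}/bracket -scalemxAl -scalemxAr -scalerBr -/(bracket _ _).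
by rewrite {1}cartan_diag bracket_diag_delta !mxE !scalerA mulrC -alpha_diff_ord.
Qed.

(** The entries of the fundamental coweight dual to the simple root k, multiplied
    by m so that they become integers; this is diag(1,..,1,0,..,0), with k ones,
    made trace-free. *)
Definition coweight (k i : nat) : int :=
  if (i < k)%N then (m - k)%:Z else - k%:Z.

Definition coweight_row (k : nat) : 'rV[C]_m := \row_i (coweight k i)%:~R.

Lemma coweight_diff k i j : (k <= m)%N ->
  coweight k i - coweight k j = m%:Z * ((i < k)%N%:Z - (j < k)%N%:Z).
Proof. by rewrite /coweight => lekm; case: ltnP => _; case: ltnP => _; lia. Qed.

Lemma sum_coweight k : (k <= m)%N -> \sum_(i < m) coweight k i = 0.
Proof.
move=> lekm; rewrite -(big_mkord xpredT (coweight k)).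
rewrite (@big_cat_nat _ _ _ k) //=.
rewrite (@eq_big_nat _ _ _ 0%N k _ (fun=> (m - k)%:Z)); last first.
  by move=> i /andP[_ ik]; rewrite /coweight ik.
rewrite (@eq_big_nat _ _ _ k m _ (fun=> - k%:Z)); last first.
  by move=> i /andP[ki _]; rewrite /coweight ltnNge ki.
rewrite !sumr_const_nat; nia.
Qed.

Lemma coweight_cartan k : (k <= m)%N ->
  diag_mx (coweight_row k) \in cartan.
Proof.
move=> lekm; rewrite mem_cartan diag_mx_is_diag mxtrace_diag /=.
under eq_bigr do rewrite mxE.
by rewrite -rmorph_sum /= sum_coweight.
Qed.

Definition coweight_elt k : subvs_of (cartan : {vspace gl}) :=
  vsproj cartan (diag_mx (coweight_row k)).

Lemma alpha_diff_coweight (i j k : nat) : (i < m)%N -> (j < m)%N -> (k <= m)%N ->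
  alpha_diff i j (coweight_elt k) = (m%:Z * ((i < k)%N%:Z - (j < k)%N%:Z))%:~R :> C.
Proof.
move=> im jm km; rewrite (alpha_diff_ord (Ordinal im) (Ordinal jm)).
rewrite /coweight_elt vsprojK ?coweight_cartan // !mxE !eqxx /=.
by rewrite -(coweight_diff _ _ km) rmorphB.
Qed.

Lemma simple_root_coweight l k : (1 <= l < m)%N -> (k <= m)%N ->
  simple_root l (coweight_elt k) = (m * (l == k))%:R :> C.
Proof.
case: l => // l /= lm km.
have lm' := ltnW lm; rewrite -/(alpha_diff l l.+1) alpha_diff_coweight //.
by rewrite [RHS]pmulrn; congr (_ *~ _); lia.
Qed.

Lemma nat_span_eval (S : set (cartan_dual R m)) a h : nat_span S a ->
  exists2 s : seq (cartan_dual R m), (forall b, b \in s -> S b) &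
    exists c : cartan_dual R m -> nat, a h = \sum_(b <- s) b h *+ c b :> C.
Proof.
case=> s sS [c ->]; exists s => //; exists c.
rewrite sum_lfunE; apply: eq_bigr => b _.
have -> : b *+ c b = (c b)%:R *: b by rewrite scaler_nat.
by rewrite scale_lfunE [LHS]mulr_natl.
Qed.

(** Evaluation at the k-th coweight picks out m times the coefficient of the
    simple root k.  It is nonnegative on any combination, which rules out j < i, and it is
    zero if the simple root k is not available. *)
Lemma nat_span_alpha_diff (Pi : set (cartan_dual R m)) (i j : 'I_m) :
  Pi `<=` Delta -> nat_span Pi (alpha_diff i j) ->
  [/\ (i <= j)%N & forall k, (i < k <= j)%N -> Pi (simple_root k)].
Proof.
move=> PiD spij.
have ev k : (k <= m)%N -> exists2 s : seq (cartan_dual R m),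
    (forall b, b \in s -> Pi b) & exists c : cartan_dual R m -> nat,
    (m%:Z * ((i < k)%N%:Z - (j < k)%N%:Z))%:~R
       = \sum_(b <- s) b (coweight_elt k) *+ c b :> C.
  move=> km; have [s sPi [c e]] := nat_span_eval (coweight_elt k) spij.
  by exists s => //; exists c; rewrite -e alpha_diff_coweight.
split=> [|k /andP[ik kj]].
  rewrite leqNgt; apply/negP => ji.
  (* If j < i, the i-th coweight takes the value - m on this functional. *)
  have [s sPi [c e]] := ev i (ltnW (ltn_ord i)).
  suff : 0 <= (m%:Z * ((i < i)%N%:Z - (j < i)%N%:Z))%:~R :> C.
    by rewrite ler0z ltnn ji; have := ltn_ord i; lia.
  rewrite e big_seq sumr_ge0 // => b /sPi/PiD [l /= lm <-].
  by rewrite mulrn_wge0 // simple_root_coweight // 1?ltnW.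
have km : (k <= m)%N by rewrite ltnW // (leq_ltn_trans kj).
apply: contrapT => nk; have [s sPi [c e]] := ev k km.
suff : (m%:Z * ((i < k)%N%:Z - (j < k)%N%:Z))%:~R == 0 :> C.
  by rewrite intr_eq0 ik ltnNge kj; have := ltn_ord i; lia.
rewrite e big_seq big1 // => b bs; have Pib := sPi _ bs.
have [l /= lm lb] := PiD _ Pib; rewrite -lb simple_root_coweight //.
case: eqVneq => [lk|_]; last by rewrite muln0 mul0rn.
by case: nk; rewrite -lk lb.
Qed.

Lemma alpha_diff_nat_span (Pi : set (cartan_dual R m)) (i j : nat) : (i <= j)%N ->
  (forall k, (i < k <= j)%N -> Pi (simple_root k)) -> nat_span Pi (alpha_diff i j).
Proof.
move=> ij Pik; exists [seq simple_root k | k <- index_iota i.+1 j.+1].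
  by move=> a /mapP[k]; rewrite mem_index_iota ltnS => /Pik ? ->.
exists (fun=> 1%N); rewrite big_map; under eq_bigr do rewrite mulr1n /simple_root -opprB.
by rewrite sumrN telescope_sumr // opprB.
Qed.

Lemma alpha_diff_positive_root (i j : 'I_m) : (i < j)%N ->
  positive_roots (alpha_diff i j).
Proof.
move=> ij; split; last first.
  apply: alpha_diff_nat_span (ltnW ij) _ => k /andP[ik kj]; exists k => //=.
  by rewrite (leq_ltn_trans _ ik) // (leq_ltn_trans kj).
have nij : i != j by rewrite neq_ltn ij.
split.
  apply/eqP => wij0; have := alpha_diff_coweight (ltn_ord i) (ltn_ord j) (ltnW (ltn_ord j)).
  rewrite wij0 zero_lfunE ij ltnn => /esym/eqP.
  by rewrite intr_eq0; have := ltn_ord i; lia.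
exists (delta_mx i j).
  by rewrite -[delta_mx i j]scale1r; exact: delta_root_space.
by apply/eqP => /matrixP/(_ i j)/eqP; rewrite !mxE !eqxx oner_eq0.
Qed.

Lemma positive_root_support a (i j : 'I_m) :
  positive_roots a -> a = alpha_diff i j -> (i < j)%N.
Proof.
move=> [[a0 _] aD] aij; rewrite aij in a0 aD.
have [ij _] := nat_span_alpha_diff (@subset_refl _ _) aD.
rewrite ltn_neqAle ij andbT; apply: contra_neq a0 => ->.
by rewrite /alpha_diff subrr.
Qed.

(** * Matrix form of the standard parabolics *)

(** The condition is vacuous on and above the diagonal; below it, it says that the
    position lies in one of the diagonal blocks of the Levi factor. *)
Definition block_support (Pi : set (cartan_dual R m)) (i j : nat) : Prop :=
  forall k, (j < k <= i)%N -> Pi (simple_root k).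

(** The diagonal part of a matrix of sl lies in the Cartan subalgebra, and each
    entry off the diagonal is a root vector, for a positive root above the
    diagonal and for the opposite of one below it. *)
Lemma std_parabolic_support (Pi : set (cartan_dual R m)) : Pi `<=` Delta ->
  std_parabolic Pi = sl_support (block_support Pi).
Proof.
move=> PiD.
have block_le (i j : nat) : (i <= j)%N -> block_support Pi i j.
  by move=> ij k /andP[jk ki]; have := leq_trans jk (leq_trans ki ij); rewrite ltnn.
apply/seteqP; split=> X /=.
  case=> _ [D cD] [_ [s sP ->] <-] [_ [t tP ->] <-].
  apply: sl_support_add; first apply: sl_support_add.
  - move: (cD); rewrite /= mem_cartan => /andP[/is_diag_mxP dD _].
    split=> [|i j nD]; first by move: cD; rewrite /= memv_cap => /andP[].
    apply: block_le; rewrite leqNgt; apply/negP => ji.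
    by rewrite dD ?eqxx // neq_ltn ji orbT in nD.
  - apply: sl_support_sum => -[a Y] /sP [/= aP aY]; split; first by case: aY.
    move=> i j /(root_space_support aY) e.
    exact/block_le/ltnW/(positive_root_support aP e).
  - apply: sl_support_sum => -[a Y] /tP [/= [aPi aP] aY]; split; first by case: aY.
    move=> i j /(root_space_support aY) /eqP; rewrite eqr_oppLR opprB => /eqP e.
    by have [_] := nat_span_alpha_diff PiD (eq_ind a _ aPi _ e).
case=> sX PX.
exists (diag_part X + off_part [rel i j : 'I_m | (i < j)%N] X); last first.
  exists (off_part [rel i j : 'I_m | (j < i)%N] X).
    exists [seq (alpha_diff p.2 p.1, X p.1 p.2 *: delta_mx p.1 p.2)
             | p : 'I_m * 'I_m <- off_diag [rel i j : 'I_m | (j < i)%N] X]; last by rewrite big_map.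
    move=> _ /mapP[[i j] + ->]; rewrite mem_off_diag /= => /andP[ji nX].
    split; last by rewrite opprB; apply: delta_root_space; rewrite neq_ltn ji orbT.
    split; last exact: alpha_diff_positive_root.
    exact/(alpha_diff_nat_span (ltnW ji))/PX.
  apply/matrixP => i j; rewrite !mxE !off_partE -val_eqE /=.
  by case: ltngtP => [_|_|/val_inj ->] /=; rewrite ?mulr0n ?mulr1n ?addr0 ?add0r.
exists (diag_part X); first exact: diag_part_cartan.
exists (off_part [rel i j : 'I_m | (i < j)%N] X) => //.
exists [seq (alpha_diff p.1 p.2, X p.1 p.2 *: delta_mx p.1 p.2)
         | p : 'I_m * 'I_m <- off_diag [rel i j : 'I_m | (i < j)%N] X]; last by rewrite big_map.
move=> _ /mapP[[i j] + ->]; rewrite mem_off_diag /= => /andP[ij nX].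
split; first exact: alpha_diff_positive_root.
by apply: delta_root_space; rewrite neq_ltn ij.
Qed.

(** This recovers [Pi] from its parabolic. *)
Lemma delta_std_parabolic (Pi : set (cartan_dual R m)) (i j : 'I_m) :
  Pi `<=` Delta -> i = j.+1 :> nat ->
  std_parabolic Pi (delta_mx i j) <-> Pi (simple_root i).
Proof.
move=> PiD ij; rewrite std_parabolic_support //; split.
  case=> _ /(_ i j); rewrite mxE !eqxx oner_eq0 => /(_ isT); apply.
  by rewrite ij ltnSn.
move=> Pii; split=> [|k l].
  by apply: delta_sl; rewrite -val_eqE /= ij; lia.
rewrite mxE; case: (eqVneq k i) => [->|]; last by rewrite eqxx.
case: (eqVneq l j) => [->|]; last by rewrite eqxx.
by move=> _ r jri; have -> : r = i by lia.
Qed.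

(** * A diagonal element defining a given standard parabolic *)

(** Up to the factor m, the entries of the sum of the fundamental coweights of the
    simple roots outside [Pi].  This point lies in the facet of the dominant
    chamber on which the simple roots vanishing are exactly those of [Pi]. *)
Definition facet_coweight (Pi : set (cartan_dual R m)) (i : nat) : int :=
  \sum_(1 <= k < m | `[< ~ Pi (simple_root k) >]) coweight k i.

Definition facet_row (Pi : set (cartan_dual R m)) : 'rV[C]_m :=
  \row_i (facet_coweight Pi i)%:~R.

Definition facet_elt (Pi : set (cartan_dual R m)) : gl :=
  diag_mx (facet_row Pi).

Lemma facet_coweight_diff Pi i j :
  facet_coweight Pi i - facet_coweight Pi j
    = m%:Z * \sum_(1 <= k < m | `[< ~ Pi (simple_root k) >])
               ((i < k)%N%:Z - (j < k)%N%:Z).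
Proof.
rewrite mulr_sumr -sumrB big_nat_cond [RHS]big_nat_cond.
apply: eq_bigr => k /andP[/andP[_ km] _]; exact/coweight_diff/ltnW.
Qed.

(** Below the diagonal every missing simple root between j and i contributes
    - m to the difference and nothing else contributes, so there is no
    cancellation. *)
Lemma facet_coweight_ge0 (Pi : set (cartan_dual R m)) (i j : 'I_m) :
  0 <= facet_coweight Pi i - facet_coweight Pi j <-> block_support Pi i j.
Proof.
have m0 : 0 < m%:Z by have := ltn_ord i; lia.
rewrite facet_coweight_diff pmulr_rge0 //; split=> [ge0 k /andP[jk ki]|block].
  have ji := leq_trans jk ki.
  apply: contrapT => nk; move: ge0; rewrite leNgt => /negP; apply.
  have km : (1 <= k < m)%N by have := ltn_ord i; lia.
  rewrite big_mkcond (bigD1_seq k) ?mem_index_iota ?iota_uniq //= asboolT //.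
  apply: ltr_wnDr; last by lia.
  by apply: sumr_le0 => l _; case: ifP => // _; lia.
rewrite big_nat_cond sumr_ge0 // => k /andP[_ /asboolP nk].
have : ~~ (j < k <= i)%N by apply/negP => /block.
by lia.
Qed.

Lemma facet_row_diff Pi (i j : 'I_m) :
  facet_row Pi 0 i - facet_row Pi 0 j = (facet_coweight Pi i - facet_coweight Pi j)%:~R.
Proof. by rewrite !mxE rmorphB. Qed.

Lemma parabolic_of_facet_elt (Pi : set (cartan_dual R m)) : Pi `<=` Delta ->
  parabolic_of (facet_elt Pi) = std_parabolic Pi.
Proof.
move=> PiD; rewrite std_parabolic_support // /parabolic_of.
rewrite sum_eigenspaces_diag /= ?lexx //.
apply/seteqP; split=> X /= [sX PX]; split=> // i j /PX.
  by rewrite facet_row_diff ler0z => /facet_coweight_ge0.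
by rewrite facet_row_diff ler0z => ?; apply/facet_coweight_ge0.
Qed.

Lemma facet_elt_sl Pi : facet_elt Pi \in sl.
Proof.
rewrite mem_sl mxtrace_diag; under eq_bigr do rewrite mxE.
rewrite -rmorph_sum /= exchange_big big_nat_cond big1 // => k /andP[/andP[_ km] _].
exact/sum_coweight/ltnW.
Qed.

Lemma facet_elt_hyperbolic Pi : hyperbolic (facet_elt Pi).
Proof.
split; first exact: facet_elt_sl.
  rewrite /semisimple sum_eigenspaces_diag //.
  by apply/seteqP; split=> X /=; [case | split].
move=> c /eqP c0; apply: contrapT => nc; apply: c0.
apply/eqP; rewrite -subv0; apply/subvP => X.
rewrite mem_ad_eigenspace memv0 => /andP[_ /eqP eX].
apply/eqP/matrixP => i j; rewrite mxE; apply/eqP/negP => /negP nX.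
move/matrixP/(_ i j): eX; rewrite bracket_diagE facet_row_diff mxE.
by move/(mulIf nX) => ec; apply: nc; rewrite -ec realz.
Qed.

(** * Reflection in the antidiagonal *)

Definition flip (X : gl) : gl := \matrix_(i, j) X (rev_ord j) (rev_ord i).

Lemma flip_delta (i j : 'I_m) :
  flip (delta_mx i j) = delta_mx (rev_ord j) (rev_ord i).
Proof.
apply/matrixP => k l; rewrite !mxE andbC.
by rewrite !(inv_eq (@rev_ordK m)).
Qed.

Lemma flip_mul X Y : flip (X *m Y) = flip Y *m flip X.
Proof.
apply/matrixP => i j; rewrite !mxE (reindex_inj rev_ord_inj) /=.
by apply: eq_bigr => k _; rewrite !mxE mulrC.
Qed.

Lemma flip_sl X : X \in sl -> flip X \in sl.
Proof.
rewrite !mem_sl; suff -> : \tr (flip X) = \tr X by [].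
rewrite [RHS](reindex_inj rev_ord_inj) /=.
by apply: eq_bigr => i _; rewrite mxE.
Qed.

(** Since flip is an anti-automorphism, flip [H, X] = [flip X, flip H], which is
    [H, flip X] when flip H = - H. *)
Lemma flip_parabolic_of H X : flip H = - H ->
  parabolic_of H X -> parabolic_of H (flip X).
Proof.
move=> fH [s sP ->]; exists [seq (u.1, flip u.2) | u <- s].
  move=> _ /mapP[[c Y] /sP /= [c0 eY] ->] /=; split=> //.
  move: eY; rewrite !mem_ad_eigenspace => /andP[sY /eqP eY].
  rewrite flip_sl //=; apply/eqP.
  have -> : c *: flip Y = flip (c *: Y) by apply/matrixP => i j; rewrite !mxE.
  rewrite -eY /bracket.
  have -> : flip (H *m Y - Y *m H) = flip (H *m Y) - flip (Y *m H).
    by apply/matrixP => i j; rewrite !mxE.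
  by rewrite !flip_mul fH mulmxN mulNmx opprK addrC.
rewrite big_map; apply/matrixP => i j; rewrite !mxE !summxE.
by apply: eq_bigr => u _; rewrite mxE.
Qed.

(** Reversing the order of the entries turns the coweight k into minus the
    coweight m - k. *)
Lemma flip_facet_elt (Pi : set (cartan_dual R m)) :
  (forall k, (1 <= k < m)%N -> Pi (simple_root k) -> Pi (simple_root (m - k))) ->
  flip (facet_elt Pi) = - facet_elt Pi.
Proof.
move=> sym; apply/matrixP => i j; rewrite !mxE (inj_eq rev_ord_inj) eq_sym.
case: eqVneq => [->|_]; last by rewrite !mulr0n oppr0.
rewrite !mulr1n -rmorphN /=; congr (_%:~R).
rewrite /facet_coweight big_nat_rev -sumrN big_nat_cond [RHS]big_nat_cond.
apply: eq_big => [k|k /andP[/andP[k1 km] _]]; last first.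
  rewrite /coweight; have := ltn_ord j; move: k1 km.
  by case: (ltnP j k) => jk; case: ifP => jk'; lia.
have [k1m|//] := boolP (1 <= k < m)%N; rewrite !andTb.
have -> : (1 + m - k.+1 = m - k)%N by lia.
apply/asbool_equiv_eq; split; apply: contra_not; first exact: sym.
have {2}-> : (k = m - (m - k))%N by lia.
by apply: sym; lia.
Qed.

(** The reflection sends the matrix unit below the diagonal of the simple root k
    to that of the simple root m - k. *)
Lemma flip_std_parabolic (Pi : set (cartan_dual R m)) : Pi `<=` Delta ->
  (forall X, std_parabolic Pi X -> std_parabolic Pi (flip X)) ->
  forall k, (1 <= k < m)%N -> Pi (simple_root k) -> Pi (simple_root (m - k)).
Proof.
move=> PiD fPi k km Pik.
have k'm : (k.-1 < m)%N by lia.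
have lkm : (k < m)%N by lia.
have := (delta_std_parabolic (i := Ordinal lkm) (j := Ordinal k'm) PiD).
case=> [/=|_ /(_ Pik)/fPi]; first by lia.
rewrite flip_delta => /(delta_std_parabolic PiD) /=.
have -> : (m - k.-1.+1 = m - k)%N by lia.
by apply; lia.
Qed.

End StandardParabolics.

(** * The orthogonal subalgebra and the classification *)

Section Orthogonal.
Variables (R : realType) (n : nat).
Local Notation C := R[i].

Lemma polar_formE (z w : 'cV[C]_(2 * n)) :
  polar_form z w = \sum_i z i 0 * w (rev_ord i) 0.
Proof.
rewrite [RHS](bigID (fun i : 'I_(2 * n) => (i < n)%N)) /=.
rewrite [X in _ + X](reindex_inj rev_ord_inj) /=.
rewrite [X in _ + X](eq_bigl (fun i : 'I_(2 * n) => (i < n)%N)); last first.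
  by move=> i /=; have := ltn_ord i; lia.
rewrite -big_split /= /polar_form /quad_form -!sumrB; apply: eq_bigr => i _.
by rewrite rev_ordK !mxE; ring.
Qed.

(** The polar form has the antidiagonal permutation matrix as Gram matrix, so the
    adjoint of a matrix is its reflection in the antidiagonal. *)
Lemma soE (X : 'M[C]_(2 * n)) : so X <-> X \in sl /\ flip X = - X.
Proof.
split=> -[sX skew]; split=> //.
  apply/matrixP => i j; rewrite !mxE.
  (* These basis vectors isolate one entry on each side of skew-adjointness. *)
  have := skew (delta_mx (rev_ord i) 0) (delta_mx j 0).
  rewrite !polar_formE (bigD1 (rev_ord j)) //= big1; last first.
    move=> k kj; rewrite !mxE; case: eqVneq => [e|_]; last by rewrite mulr0.
    by rewrite -e rev_ordK eqxx in kj.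
  rewrite [in RHS](bigD1 (rev_ord i)) //= [in RHS]big1; last first.
    by move=> k kj; rewrite !mxE (negbTE kj) mul0r.
  rewrite -!colE !mxE !rev_ordK !eqxx mul1r mulr1 !addr0; exact.
move=> z w; rewrite !polar_formE.
under eq_bigr do rewrite mxE mulr_suml.
rewrite exchange_big -sumrN /=; apply: eq_bigr => i _.
rewrite mxE mulr_sumr -sumrN (reindex_inj rev_ord_inj) /=; apply: eq_bigr => k _.
rewrite rev_ordK.
have -> : X (rev_ord k) i = - X (rev_ord i) k.
  move/matrixP/(_ (rev_ord i) k): skew; rewrite !mxE rev_ordK => <-; by [].
ring.
Qed.

End Orthogonal.

Theorem proposition8 (R : realType) (n : nat) (hn : (1 <= n)%N)
    (Pi : set (cartan_dual R (2 * n))) (hPi : Pi `<=` Delta) :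
  compatible so (std_parabolic Pi) <->
  (forall k : nat, (1 <= k <= n - 1)%N ->
     let pair := [set alpha k - alpha (k + 1)%N;
                      alpha (2 * n - k)%N - alpha (2 * n + 1 - k)%N] in
     pair `<=` Pi \/ pair `&` Pi = set0).
Proof.
have pairE k : (1 <= k <= n - 1)%N ->
    [set alpha k - alpha (k + 1)%N;
       alpha (2 * n - k)%N - alpha (2 * n + 1 - k)%N]
    = [set simple_root k; simple_root (2 * n - k)%N] :> set (cartan_dual R (2 * n)).
  move=> kn; rewrite /simple_root addn1.
  by have -> : (2 * n + 1 - k = (2 * n - k).+1)%N by lia.
split=> [[H [/soE[_ flipH] _ pH]] k kn /=|pairs].
  have sym : forall l, (1 <= l < 2 * n)%N ->
      Pi (simple_root l) -> Pi (simple_root (2 * n - l)).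
    by apply: flip_std_parabolic => // X; rewrite pH; exact: flip_parabolic_of.
  rewrite pairE //; have [Pik|nPik] := pselect (Pi (simple_root k)); [left|right].
    by move=> _ [->|->] //; apply: sym => //; lia.
  apply/seteqP; split=> // _ [[->|->]] //= Pik'; apply: nPik.
  by have := sym (2 * n - k)%N; rewrite subKn; [apply=> //|]; lia.
exists (facet_elt Pi); split; [|exact: facet_elt_hyperbolic|].
  apply/soE; split; first exact: facet_elt_sl.
  apply: flip_facet_elt => k k2n Pik.
  have both l : (1 <= l <= n - 1)%N ->
      Pi (simple_root l) \/ Pi (simple_root (2 * n - l)) ->
      Pi (simple_root l) /\ Pi (simple_root (2 * n - l)).
    move=> ln some; have := pairs l ln; rewrite /= pairE // => -[sub|dis].
      by split; apply: sub; [left|right].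
    move/seteqP: dis => [dis _].
    by case: some => Pil; case: (dis _ (conj _ Pil)); [left|right].
  have [kn|nk|ekn] := ltngtP k n.
  - by apply: (both k _ _).2; [lia | left].
  - apply: (both (2 * n - k)%N _ _).1; first by lia.
    by right; rewrite subKn //; lia.
  - by have -> : (2 * n - k = k)%N by lia.
by rewrite parabolic_of_facet_elt.
Qed.
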